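(* Let $\|\cdot\|$ be a norm on $\mathbb{R}^2$ and $\aleph_0=\{\mathbf{v}\in\mathbb{R}_+^2:\|\mathbf{v}\|=1\}$. Let $h\in RV_\rho$ with $\rho<0$, and let $u:\mathbb{Z}_+^2\to\mathbb{R}_+$ be such that there exists a limit function $\lambda_0>0$ defined on $\aleph_0$ with $$\lim_{t\to\infty}\frac{u([tx],[ty])}{h(t)}=\lambda_0(x,y)\qquad\text{for all }(x,y)\in\aleph_0, \qquad( * )$$ where $t$ runs through the positive reals. Then: 1. The doubly indexed function $u(i,j)$ is regularly varying: for all $x,y>0$, $$\lim_{n\to\infty}\frac{u([nx],[ny])}{h(n)}=\lambda(x,y):=\lambda_0\left(\frac{(x,y)}{\|(x,y)\|}\right)\|(x,y)\|^{\rho}>0 .$$ 2. $u(i,j)$ is embeddable in a regularly varying function $f:\mathbb{R}_+^2\to\mathbb{R}$ with limit function $\lambda(\cdot)$ such that $f(x,y)=u([x],[y])$. 3. If the convergence in $( * )$ is uniform on $\aleph_0$, then $f$ also satisfies $$\lim_{t\to\infty}\ \sup_{(x,y)\in\aleph_0}\left|\frac{f(tx,ty)}{h(t)}-\lambda_0(x,y)\right|=0 .$$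
   Context: $\mathbb{Z}_+=\{0,1,2,\dots\}$, $\mathbb{R}_+=[0,\infty)$, and $[x]$ is the largest integer $\le x$. For $\rho\in\mathbb{R}$, $h\in RV_\rho$ means that $h:(0,\infty)\to(0,\infty)$ is measurable and $\lim_{t\to\infty}h(tx)/h(t)=x^\rho$ for all $x>0$. A measurable function $f$ on $\mathbb{R}_+^2$ is (standard) regularly varying with limit function $\lambda$ if there is $h\in RV_\alpha$ for some $\alpha\in\mathbb{R}$ such that $\lim_{t\to\infty}f(tx,ty)/h(t)=\lambda(x,y)>0$ for all $x,y>0$ ($t$ real). $u$ is embeddable if $f(x,y):=u([x],[y])$ is regularly varying in this sense. *)

(* Defs.v *)
From HB Require Import structures.
From mathcomp Require Import all_boot all_order all_algebra.
From mathcomp Require Import all_classical all_reals all_analysis.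

Set Implicit Arguments.
Unset Strict Implicit.
Unset Printing Implicit Defensive.

Import Order.TTheory GRing.Theory Num.Theory.
Import numFieldNormedType.Exports.

Local Open Scope classical_set_scope.
Local Open Scope ring_scope.

(* An arbitrary norm on R^2. The norm that the library attaches to [R * R] is
   the sup norm, so [N] is a separate function; scaling is written
   coordinatewise. *)
Definition is_norm2 (R : realType) (N : R * R -> R) : Prop :=
  [/\ forall v, 0 <= N v,
      forall v, N v = 0 -> v = 0,
      forall a x y : R, N (a * x, a * y) = `|a| * N (x, y)
    & forall v w, N (v + w) <= N v + N w].

Definition quadrant (R : realType) : set (R * R) :=
  [set v | 0 <= v.1 /\ 0 <= v.2].
Arguments quadrant R : clear implicits.

Definition unit_quadrant (R : realType) (N : R * R -> R) : set (R * R) :=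
  quadrant R `&` [set v | N v = 1].

(* [h] stands for a function (0, +oo) -> (0, +oo): its values outside (0, +oo)
   are unconstrained. *)
Definition RV (R : realType) (rho : R) (h : R -> R) : Prop :=
  [/\ measurable_fun (`]0, +oo[%classic : set R) h,
      forall t : R, 0 < t -> 0 < h t
    & forall x : R, 0 < x -> h (t * x) / h t @[t --> +oo] --> x `^ rho].

(* [f] stands for a function on the closed quadrant and [lam] for one on the
   open quadrant. *)
Definition regularly_varying2 (R : realType) (f lam : R * R -> R) : Prop :=
  measurable_fun (quadrant R) f /\
  exists (alpha : R) (h : R -> R), RV alpha h /\
    forall x y : R, 0 < x -> 0 < y ->
      f (t * x, t * y) / h t @[t --> +oo] --> lam (x, y) /\ 0 < lam (x, y).

(* [Num.truncn] is the integer part on nonnegative reals. *)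
Definition floor_ext (R : realType) (u : nat -> nat -> R) (v : R * R) : R :=
  u (Num.truncn v.1) (Num.truncn v.2).

Definition radial_ext (R : realType) (N : R * R -> R) (rho : R)
    (lam0 : R * R -> R) (v : R * R) : R :=
  lam0 (v.1 / N v, v.2 / N v) * N v `^ rho.

(* Main.v *)
Require Import Defs.
From HB Require Import structures.
From mathcomp Require Import all_boot all_order all_algebra.
From mathcomp Require Import all_classical all_reals all_analysis.

Import Order.TTheory GRing.Theory Num.Theory.
Import numFieldNormedType.Exports.

Local Open Scope classical_set_scope.
Local Open Scope ring_scope.

Section norm2.
Context {R : realType} {N : R * R -> R}.
Hypothesis hN : is_norm2 N.

Lemma norm2_gt0 v : v != 0 -> 0 < N v.
Proof.
case: hN => N0 Neq0 _ _ v0; rewrite lt_neqAle N0 andbT eq_sym.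
by apply: contra_neq v0; exact: Neq0.
Qed.

Lemma unit_quadrant_normalize v : quadrant R v -> v != 0 ->
  unit_quadrant N (v.1 / N v, v.2 / N v).
Proof.
move=> [v1 v2] v0; have Nv := norm2_gt0 _ v0; case: hN => _ _ NZ _.
split; first by split; rewrite /= divr_ge0// ltW.
(* Commuting the factors exposes the common scalar [(N v)^-1], to which homogeneity of [N]
   applies. *)
rewrite /= mulrC (mulrC v.2) NZ -surjective_pairing gtr0_norm ?invr_gt0//.
by rewrite mulVf// gt_eqF.
Qed.

(** Rules out the value [-oo] that [ereal_sup] takes on the empty set. *)
Lemma unit_quadrant_neq0 : unit_quadrant N !=set0.
Proof.
exists (1 / N (1, 0), 0 / N (1, 0)); apply: (unit_quadrant_normalize (1, 0)).
  by split=> /=.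
by apply/eqP => -[] /eqP; rewrite oner_eq0.
Qed.

End norm2.

Lemma radial_ext_gt0 {R : realType} {N lam0 : R * R -> R} (rho : R) v :
  is_norm2 N -> (forall w, unit_quadrant N w -> 0 < lam0 w) ->
  quadrant R v -> v != 0 -> 0 < radial_ext N rho lam0 v.
Proof.
move=> hN lam0_gt0 qv v0; rewrite /radial_ext mulr_gt0 ?powR_gt0 ?(norm2_gt0 hN)//.
exact: lam0_gt0 (unit_quadrant_normalize hN _ qv v0).
Qed.

(* With [r = N v], write [g (t v) / h t = g ((t r) (v / r)) / h (t r)
   * (h (t r) / h t)]: the first factor is a ray limit in the direction
   [v / r], the second is the regular variation of [h]. *)
Lemma cvg_radial_ext {R : realType} {N : R * R -> R} {rho : R} {h : R -> R}
    {g lam0 : R * R -> R} v :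
  is_norm2 N -> RV rho h ->
  (forall w, unit_quadrant N w ->
    g (t * w.1, t * w.2) / h t @[t --> +oo] --> lam0 w) ->
  quadrant R v -> v != 0 ->
  g (t * v.1, t * v.2) / h t @[t --> +oo] --> radial_ext N rho lam0 v.
Proof.
move=> hN [_ h_gt0 hRV] glim qv v0; have r0 := norm2_gt0 hN _ v0.
set r := N v in r0 *.
have ray := glim _ (unit_quadrant_normalize hN _ qv v0).
have tr : t * r @[t --> +oo] --> +oo by apply: gt0_cvgMly.
have prod : g (t * r * (v.1 / r), t * r * (v.2 / r)) / h (t * r) *
    (h (t * r) / h t) @[t --> +oo] --> radial_ext N rho lam0 v.
  exact: cvgM (cvg_comp _ _ tr ray) (hRV _ r0).
apply: cvg_trans prod; apply: near_eq_cvg; near=> t.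
(* Cancelling [h (t * r)] requires it to be nonzero, and [h] is known to be positive only at
   positive arguments. *)
have t0 : 0 < t by near: t; exact: nbhs_pinfty_gt.
rewrite /= mulrA divfK ?gt_eqF ?h_gt0 ?mulr_gt0//.
have scale a : t * r * (a / r) = t * a.
  by rewrite -mulrA (mulrC r) divfK ?gt_eqF.
by rewrite !scale.
Unshelve. all: by end_near. Qed.

(** [floor_ext u] is constant on each product of two cells [[i, i+1[] and [[j, j+1[]. These products
    tile the quadrant, so every preimage is a countable union of measurable rectangles. *)
Lemma measurable_floor_ext {R : realType} (u : nat -> nat -> R) :
  measurable_fun (quadrant R) (floor_ext u).
Proof.
pose cell (i : nat) : set R := `[i%:R, i.+1%:R[%classic.
have mcell i : measurable (cell i) by exact: measurable_itv.
move=> _ Y mY.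
have -> : quadrant R `&` floor_ext u @^-1` Y =
    \bigcup_i \bigcup_(j in [set j | Y (u i j)]) (cell i `*` cell j).
  (* The sign condition matters: [Num.truncn] sends negative numbers to 0, though they lie outside
     cell 0. *)
  have cellE (x : R) i : 0 <= x -> cell i x = (Num.truncn x = i).
    move=> x0; rewrite /cell /= in_itv/= -truncn_eq//.
    by apply/propext; split=> /eqP.
  apply/seteqP; split=> [[x y] [[/= x0 y0] Yxy]|].
    exists (Num.truncn x) => //; exists (Num.truncn y) => //.
    by split; rewrite /= cellE.
  move=> [x y] [i _ [j /= Yij] [/= cx cy]].
  have cell_ge0 k z : cell k z -> 0 <= z.
    by rewrite /cell /= in_itv/= => /andP[+ _]; exact: le_trans.
  have [x0 y0] := (cell_ge0 _ _ cx, cell_ge0 _ _ cy).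
  split=> //; rewrite /floor_ext /=.
  by move: cx cy; rewrite !cellE// => -> ->.
apply: bigcupT_measurable => i; apply: bigcup_measurable => j _.
exact: measurableX.
Qed.

(** Uniform closeness within [e] on [A] bounds the supremum by [e]. The supremum is taken in the
    extended reals because the deviations at a given [t] may be unbounded; they are bounded only
    eventually along [F]. *)
Lemma uniform_cvg_ereal_sup {R : realType} {I : Type} {T : choiceType} {A : set T}
    {F : set_system I} {FF : Filter F} (f : I -> T -> R) (l : T -> R) :
  A !=set0 -> {uniform A, f @ F --> l} ->
  ereal_sup [set (`|f t v - l v|)%:E | v in A] @[t --> F] --> 0%E.
Proof.
move=> [a Aa] ful.
have bound (e : R) : 0 < e -> \forall t \near F,
    (0 <= ereal_sup [set (`|f t v - l v|)%:E | v in A] <= e%:E)%E.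
  move=> e0.
  have fe : \forall t \near F, forall v, A v -> `|l v - f t v| < e.
    apply: (ful [set g | forall v, A v -> `|l v - g v| < e]).
    (* The functions within [e] of [l] on [A] form a uniform neighbourhood of [l], given by the
       entourage of pairs at distance less than [e]. *)
    apply/uniform_nbhs; exists [set xy | `|xy.1 - xy.2| < e]; split => //.
    by rewrite -entourage_ballE; exists e.
  near=> t; apply/andP; split.
    (* The deviation at the point [a] of [A] is a nonnegative element of the set. *)
    by apply: le_trans (ereal_sup_ubound _); last by exists a.
  apply: ge_ereal_sup => _ [v Av <-]; rewrite lee_fin distrC ltW//.
  by move: v Av; near: t.
(* Two parts remain: the supremum is eventually finite, by the bound with the arbitrary constant 1,
   and its real part tends to 0. *)
apply/fine_cvgP; split.
  near=> t.
  have /andP[s0 s1] : (0 <= ereal_sup [set (`|f t v - l v|)%:E | v in A] <= 1%:E)%E.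
    by near: t; exact: bound.
  by rewrite ge0_fin_numE// (le_lt_trans s1)// ltry.
apply/cvgrPdist_le => e e0; near=> t.
have /andP[s0 s1] : (0 <= ereal_sup [set (`|f t v - l v|)%:E | v in A] <= e%:E)%E.
  by near: t; exact: bound.
rewrite sub0r normrN /= ger0_norm ?fine_ge0//.
by rewrite -lee_fin fineK// ge0_fin_numE// (le_lt_trans s1)// ltry.
Unshelve. all: by end_near. Qed.

Theorem theorem4p1 (R : realType) (N : R * R -> R) (rho : R) (h : R -> R)
    (u : nat -> nat -> R) (lam0 : R * R -> R)
    (hN : is_norm2 N) (hrho : rho < 0) (hh : RV rho h)
    (hu : forall i j : nat, 0 <= u i j)
    (hlam0 : forall v : R * R, unit_quadrant N v -> 0 < lam0 v)
    (hlim : forall x y : R, unit_quadrant N (x, y) ->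
       u (Num.truncn (t * x)) (Num.truncn (t * y)) / h t @[t --> +oo]
         --> lam0 (x, y)) :
  [/\ forall x y : R, 0 < x -> 0 < y ->
        u (Num.truncn (n%:R * x)) (Num.truncn (n%:R * y)) / h n%:R @[n --> \oo]
          --> radial_ext N rho lam0 (x, y)
        /\ 0 < radial_ext N rho lam0 (x, y),
      regularly_varying2 (floor_ext u) (radial_ext N rho lam0)
    & {uniform unit_quadrant N,
         (fun (t : R) (v : R * R) =>
            u (Num.truncn (t * v.1)) (Num.truncn (t * v.2)) / h t) @ +oo
         --> lam0} ->
      ereal_sup [set (`|floor_ext u (t * v.1, t * v.2) / h t - lam0 v|)%:E
                | v in unit_quadrant N] @[t --> +oo] --> 0%E].
Proof.
have ray w : unit_quadrant N w ->
    floor_ext u (t * w.1, t * w.2) / h t @[t --> +oo] --> lam0 w.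
  by case: w => x y; exact: hlim.
have open_quadrant x y : 0 < x -> 0 < y -> quadrant R (x, y) /\ (x, y) != 0.
  move=> x0 y0; split; first by split; exact: ltW.
  by apply: contraTneq x0 => -[-> _]; rewrite ltxx.
have lim x y (x0 : 0 < x) (y0 : 0 < y) :
    floor_ext u (t * x, t * y) / h t @[t --> +oo] --> radial_ext N rho lam0 (x, y)
    /\ 0 < radial_ext N rho lam0 (x, y).
  have [qxy xy0] := open_quadrant _ _ x0 y0; split; last exact: radial_ext_gt0.
  exact: (cvg_radial_ext (x, y)).
split=> [x y x0 y0||].
(* The limit along real [t] is restricted to the integers, since [n%:R] tends to [+oo]. *)
- by have [xylim ?] := lim _ _ x0 y0; split=> //; exact: cvg_comp _ _ cvgr_idn xylim.
(* The index and the normalizing function of the embedding are the given [rho] and [h]. *)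
- by split; [exact: measurable_floor_ext|exists rho, h].
- move=> unif; apply: uniform_cvg_ereal_sup unif; exact: unit_quadrant_neq0 hN.
Qed.
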